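(* Let $\alpha>-1$ be real and let $n\in\mathbb{N}\cup\{0\}$. Suppose that $$\frac{1}{e}\left[\Re(\alpha-1)-n\right]>0.$$ Then $M_{n,\alpha}\in\mathcal{P}_e$, i.e. $M_{n,\alpha}(z)\prec e^z$ in $\mathbb{D}$.
   Context: $\mathbb{D}=\{z\in\mathbb{C}:|z|<1\}$. For $\alpha>-1$ and $n\in\mathbb{N}\cup\{0\}$, the normalized Laguerre polynomial is $$M_{n,\alpha}(z)=\sum_{k=0}^{n}\frac{(-1)^k\, n!}{(1+\alpha)_k\,(n-k)!}\,\frac{z^k}{k!},$$ where $(a)_k=\Gamma(a+k)/\Gamma(a)$ is the Pochhammer symbol. For functions $g,h$ analytic in $\mathbb{D}$, $g$ is subordinate to $h$, written $g\prec h$, if there is an analytic $w:\mathbb{D}\to\mathbb{C}$ with $w(0)=0$ and $|w(z)|<1$ for $z\in\mathbb{D}$ such that $g(z)=h(w(z))$ for all $z\in\mathbb{D}$. $\mathcal{P}_e$ is the class of analytic functions $p$ in $\mathbb{D}$ with $p(0)=1$ and $p(z)\prec e^z$. *)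

(* Defs.v *)
From Stdlib Require Import Factorial Reals.
From Coquelicot Require Import Coquelicot.

Open Scope R_scope.

Definition unit_disc (z : C) : Prop := Cmod z < 1.

(* The unit disc is open, so analyticity there is complex differentiability at
   each of its points; values of f outside the disc are irrelevant. *)
Definition analytic_in_disc (f : C -> C) : Prop :=
  forall z : C, unit_disc z -> @ex_derive C_AbsRing C_NormedModule f z.

Definition Cexp (z : C) : C :=
  (RtoC (exp (Re z)) * (RtoC (cos (Im z)) + Ci * RtoC (sin (Im z))))%C.

(* Euler's integral; it converges, and thus is meaningful, for a > 0. *)
Definition Gamma (a : R) : R :=
  RInt_gen (fun t : R => Rpower t (a - 1) * exp (- t))
    (at_right 0) (Rbar_locally p_infty).

(* Only used with a = 1 + alpha > 0, where both Gamma values are positive. *)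
Definition Pochhammer (a : R) (k : nat) : R := Gamma (a + INR k) / Gamma a.

Definition M (n : nat) (alpha : R) (z : C) : C :=
  sum_n (fun k : nat =>
    (RtoC ((-1) ^ k * INR (fact n)
           / (Pochhammer (1 + alpha) k * INR (fact (n - k))))
     * (z ^ k / RtoC (INR (fact k))))%C) n.

Definition subordinate (g h : C -> C) : Prop :=
  exists w : C -> C,
    analytic_in_disc w /\
    w (RtoC 0) = RtoC 0 /\
    (forall z : C, unit_disc z -> Cmod (w z) < 1) /\
    (forall z : C, unit_disc z -> g z = h (w z)).

Definition P_e (p : C -> C) : Prop :=
  analytic_in_disc p /\ p (RtoC 0) = RtoC 1 /\ subordinate p Cexp.

(* Main.v *)
Require Import Defs.
From Stdlib Require Import Arith Factorial Reals Lra Lia FunctionalExtensionality.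
From Coquelicot Require Import Coquelicot.

(* The derivatives of f = M n alpha satisfy
     z f^(j+2) + (1 + alpha + j - z) f^(j+1) + (n - j) f^(j) = 0.
   As 1 + alpha > n + 2, descending induction on j from the constant f^(n) gives
   f^(j) <> 0 and |f^(j+1)| <= |f^(j)| on the disc.  Hence |f'/f| <= 1 there,
   and w(z), the integral of f'/f from 0 to z, is a logarithm of f with
   |w(z)| <= |z| < 1. *)

Open Scope R_scope.

(** * Kummer's equation for polynomials *)

(** The margin 2 in [1 + alpha > n + 2] comes from solving the equation for
    [(1 + alpha + j) f^(j+1)]: the terms [z f^(j+1)] and [z f^(j+2)] remain, and each is at most
    [|f^(j+1)|] in modulus, the second one by the induction hypothesis. Passing from [j] to [j + 1]
    raises [1 + alpha + j] and lowers [n - j], so the margin never shrinks. To run this induction, a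
    polynomial is given by the sequence of its derivatives at 0, on which differentiation is an
    index shift, and all derivatives are summed up to the same degree. Since the Pochhammer symbols
    are quotients of Euler integrals, the coefficient recurrence itself rests on the convergence and
    the functional equation of Gamma; as [1 + alpha > 2], both are proved for arguments above 1. *)

Definition egf (s : nat -> R) (N : nat) (z : C) : C :=
  sum_n (fun k : nat => (RtoC (s k) * (z ^ k / RtoC (INR (fact k))))%C) N.

Definition shift (s : nat -> R) (k : nat) : R := s (S k).

(** The coefficient of [z^k / k!] in [z f'' + (b - z) f' + m f = 0], where [f] is the exponential
    generating function of [s]. *)
Definition kummer_rec (b m : R) (s : nat -> R) : Prop :=
  forall k : nat, (b + INR k) * s (S k) = - (m - INR k) * s k.

Lemma egf_0 (s : nat -> R) (z : C) : egf s 0 z = RtoC (s 0%nat).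
Proof.
unfold egf; rewrite sum_O; simpl; field.
Qed.

Lemma egf_S (s : nat -> R) (N : nat) (z : C) :
  egf s (S N) z
  = (egf s N z + RtoC (s (S N)) * (z ^ S N / RtoC (INR (fact (S N)))))%C.
Proof. exact (sum_Sn _ N). Qed.

Lemma RtoC_fact_neq_0 (k : nat) : RtoC (INR (fact k)) <> RtoC 0.
Proof. intros E; apply RtoC_inj in E; now apply (INR_fact_neq_0 k). Qed.

Lemma RtoC_INR_S_neq_0 (k : nat) : RtoC (INR (S k)) <> RtoC 0.
Proof. intros E; apply RtoC_inj in E; revert E; apply not_0_INR; lia. Qed.

Lemma RtoC_fact_S (k : nat) :
  RtoC (INR (fact (S k))) = (RtoC (INR (S k)) * RtoC (INR (fact k)))%C.
Proof. now rewrite <- RtoC_mult, <- mult_INR. Qed.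

Lemma egf_at_0 (s : nat -> R) (N : nat) : egf s N (RtoC 0) = RtoC (s 0%nat).
Proof.
induction N as [|N IH]; [apply egf_0|].
rewrite egf_S, IH; simpl Cpow. unfold Cdiv; ring.
Qed.

Lemma kummer_rec_shift (b m : R) (s : nat -> R) :
  kummer_rec b (m + 1) s -> kummer_rec (b + 1) m (shift s).
Proof.
intros Hs k; unfold shift; specialize (Hs (S k)); rewrite S_INR in Hs; lra.
Qed.

(** The factor [m - k] is zero at [k = m], while [b + k] stays positive. *)
Lemma kummer_rec_vanish (b : R) (m : nat) (s : nat -> R) :
  0 < b -> kummer_rec b (INR m) s -> forall k : nat, (m < k)%nat -> s k = 0.
Proof.
intros Hb Hs k Hk; induction Hk as [|k Hk IH].
- specialize (Hs m); pose proof (pos_INR m).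
  apply (Rmult_eq_reg_l (b + INR m)); lra.
- specialize (Hs k); rewrite IH in Hs; pose proof (pos_INR k).
  apply (Rmult_eq_reg_l (b + INR k)); lra.
Qed.

(** Multiplication by [z] raises the degree of two of the truncated sums by one: every degree up to
    [N] cancels by the recurrence, and only degree [N + 1] survives. Keeping this remainder is what
    lets the induction on [N] go through. *)
Lemma kummer_ode_remainder (b m : R) (s : nat -> R) (N : nat) (z : C) :
  kummer_rec b m s ->
  (z * egf (shift (shift s)) N z + (RtoC b - z) * egf (shift s) N z
   + RtoC m * egf s N z
   = RtoC (s (S (S N)) - s (S N)) * (z ^ S N / RtoC (INR (fact N))))%C.
Proof.
intros Hs; induction N as [|N IH].
- rewrite !egf_0; unfold shift.
  assert (E := Hs 0%nat); simpl in E.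
  assert (E' : (RtoC b * RtoC (s 1%nat) = - RtoC m * RtoC (s 0%nat))%C).
  { rewrite <- !RtoC_mult, <- RtoC_opp, <- RtoC_mult; f_equal; lra. }
  rewrite RtoC_minus; simpl.
  replace ((RtoC b - z) * RtoC (s 1%nat))%C
    with (RtoC b * RtoC (s 1%nat) - z * RtoC (s 1%nat))%C by ring.
  rewrite E'; field.
- rewrite !egf_S.
  set (a := RtoC (INR (fact (S N)))).
  transitivity ((z * egf (shift (shift s)) N z
    + (RtoC b - z) * egf (shift s) N z + RtoC m * egf s N z)
    + (z * RtoC (s (S (S (S N)))) + (RtoC b - z) * RtoC (s (S (S N)))
       + RtoC m * RtoC (s (S N))) * (z ^ S N / a))%C.
  { change (shift (shift s) (S N)) with (s (S (S (S N)))).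
    change (shift s (S N)) with (s (S (S N))); ring. }
  rewrite IH; clear IH.
  unfold a; rewrite RtoC_fact_S.
  assert (E := Hs (S N)).
  assert (E' : (RtoC b * RtoC (s (S (S N)))
    = - RtoC (INR (S N)) * RtoC (s (S (S N)))
      - (RtoC m - RtoC (INR (S N))) * RtoC (s (S N)))%C).
  { rewrite <- RtoC_minus, <- RtoC_opp, <- !RtoC_mult, <- RtoC_minus; f_equal; lra. }
  replace ((RtoC b - z) * RtoC (s (S (S N))))%C
    with (RtoC b * RtoC (s (S (S N))) - z * RtoC (s (S (S N))))%C by ring.
  rewrite E', !RtoC_minus; clear.
  rewrite (Cpow_S z (S N)).
  field; split; [apply RtoC_fact_neq_0 | apply RtoC_INR_S_neq_0].
Qed.

Lemma kummer_ode (b : R) (m N : nat) (s : nat -> R) (z : C) :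
  0 < b -> (m <= N)%nat -> kummer_rec b (INR m) s ->
  (z * egf (shift (shift s)) N z + (RtoC b - z) * egf (shift s) N z
   + RtoC (INR m) * egf s N z = 0)%C.
Proof.
intros Hb HmN Hs; rewrite (kummer_ode_remainder _ _ _ _ _ Hs).
rewrite !(kummer_rec_vanish b m s Hb Hs) by lia.
rewrite Rminus_0_r; ring.
Qed.

Lemma egf_const (s : nat -> R) (N : nat) (z : C) :
  (forall k : nat, (0 < k)%nat -> s k = 0) -> egf s N z = RtoC (s 0%nat).
Proof.
intros Hs; induction N as [|N IH]; [apply egf_0|].
rewrite egf_S, IH, (Hs (S N)) by lia; ring.
Qed.

(* Dividing the differential equation by the first derivative gives
   m |f / f'| >= |b - z| - |z| |f'' / f'|, and f' satisfies the same type of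
   equation with parameters b + 1 and m - 1. *)
Lemma kummer_logderiv_bound (N m : nat) (b : R) (s : nat -> R) (z : C) :
  (m <= N)%nat -> INR m + 2 < b -> kummer_rec b (INR m) s ->
  s 0%nat <> 0 -> Cmod z <= 1 ->
  egf s N z <> RtoC 0 /\ Cmod (egf (shift s) N z) <= Cmod (egf s N z).
Proof.
intros HmN; revert b s; induction m as [|m IH]; intros b s Hb Hs Hs0 Hz.
- assert (Hv := kummer_rec_vanish b 0 s ltac:(simpl in Hb; lra) Hs).
  rewrite (egf_const s) by exact Hv.
  rewrite (egf_const (shift s)) by (intros k _; apply Hv; lia).
  unfold shift; rewrite (Hv 1%nat) by lia.
  split.
  + intros E; apply RtoC_inj in E; contradiction.
  + rewrite Cmod_0; apply Cmod_ge_0.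
- pose proof (pos_INR m) as Hm.
  assert (Hb' := Hb); rewrite S_INR in Hb'.
  assert (Hode := kummer_ode b (S m) N s z ltac:(lra) HmN Hs).
  (* At index 0 the recurrence reads [b s_1 = -(m + 1) s_0]. *)
  assert (Hs1 : shift s 0 <> 0).
  { unfold shift; intros E; specialize (Hs 0%nat); rewrite E, S_INR in Hs.
    simpl INR in Hs; apply Hs0; apply (Rmult_eq_reg_l (INR m + 1)); lra. }
  assert (Hsh : kummer_rec (b + 1) (INR m) (shift s)).
  { apply kummer_rec_shift; rewrite <- S_INR; exact Hs. }
  destruct (IH ltac:(lia) (b + 1) (shift s) ltac:(lra) Hsh Hs1 Hz) as [H0 H1].
  set (f := egf s N z) in *; set (f1 := egf (shift s) N z) in *.
  set (f2 := egf (shift (shift s)) N z) in *.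
  assert (Hf1 : 0 < Cmod f1) by now apply Cmod_gt_0.
  assert (Hineq : b * Cmod f1 <= INR (S m) * Cmod f + 2 * Cmod f1).
  { replace (b * Cmod f1) with (Cmod (RtoC b * f1)%C)
      by (rewrite Cmod_mult, Cmod_R, Rabs_pos_eq; lra).
    replace (RtoC b * f1)%C
      with (- (RtoC (INR (S m)) * f) + (z * f1 + - (z * f2)))%C.
    - eapply Rle_trans; [apply Cmod_triangle|].
      rewrite Cmod_opp, Cmod_mult, Cmod_R, (Rabs_pos_eq (INR (S m)))
        by apply pos_INR.
      apply Rplus_le_compat_l.
      eapply Rle_trans; [apply Cmod_triangle|].
      rewrite Cmod_opp, !Cmod_mult.
      pose proof (Cmod_ge_0 z); pose proof (Cmod_ge_0 f2); nra.
    - replace (RtoC b * f1)%C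
        with (z * f1 - z * f2 - RtoC (INR (S m)) * f
              + (z * f2 + (RtoC b - z) * f1 + RtoC (INR (S m)) * f))%C by ring.
      rewrite Hode; ring. }
  rewrite S_INR in Hineq; pose proof (Cmod_ge_0 f).
  (* As [b - 2 > m + 1] and [f1] is nonzero, [Hineq] forces [|f1| < |f|], which gives both
     claims. *)
  split; [apply Cmod_gt_0|]; nra.
Qed.

(** * Complex differentiability *)

(* Coquelicot puts on C, as a module over itself, both this structure and
   C_NormedModule; [is_derive_mult] exists only for this one, whereas
   [analytic_in_disc] uses the other.  [Cdiff] mediates between them. *)
Local Notation C_self := (AbsRing_NormedModule C_AbsRing).

Definition Cdiff (f : C -> C) (z l : C) : Prop :=
  forall eps : R, 0 < eps -> exists d : R, 0 < d /\
    forall y : C, Cmod (y - z) < d ->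
      Cmod (f y - f z - (y - z) * l) <= eps * Cmod (y - z).

Lemma is_derive_Cdiff (f : C -> C) (z l : C) :
  is_derive (V := C_self) f z l -> Cdiff f z l.
Proof.
intros [_ H] eps Heps.
destruct (H z (fun P HP => HP) (mkposreal eps Heps)) as [d Hd].
exists d; split; [apply cond_pos|].
intros y Hy; exact (Hd y Hy).
Qed.

Lemma Cdiff_is_derive (f : C -> C) (z l : C) :
  Cdiff f z l -> @is_derive C_AbsRing C_NormedModule f z l.
Proof.
intros H; split; [exact (is_linear_scal_l (V := C_NormedModule) l)|].
intros x Hx.
replace x with z
  by exact (is_filter_lim_locally_unique (V := C_self) z x Hx).
intros eps; destruct (H eps (cond_pos eps)) as [d [Hd Hy]].
exists (mkposreal d Hd); intros y Hball.
assert (E := Hy y Hball).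
exact E.
Qed.

Lemma is_derive_Cpow (n : nat) (z : C) :
  is_derive (V := C_self)
    (fun x : C => (x ^ S n)%C) z (RtoC (INR (S n)) * z ^ n)%C.
Proof.
induction n as [|n IH].
- apply (is_derive_ext (V := C_self) (fun x : C => x)).
  + intros x; symmetry; exact (Cmult_1_r x).
  + replace (RtoC (INR 1) * z ^ 0)%C with (RtoC 1) by (simpl; ring).
    apply (is_derive_id (K := C_AbsRing)).
- assert (H := is_derive_mult (K := C_AbsRing) (fun x : C => x) _ z _ _
    (is_derive_id (K := C_AbsRing) z) IH Cmult_comm).
  replace (RtoC (INR (S (S n))) * z ^ S n)%C
    with (plus (G := C_AbsRing) (mult one (z ^ S n)%C)
      (mult z (RtoC (INR (S n)) * z ^ n)%C)).
  + exact H.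
  + rewrite (S_INR (S n)), RtoC_plus.
    change (RtoC 1 * z ^ S n + z * (RtoC (INR (S n)) * z ^ n)
      = (RtoC (INR (S n)) + RtoC 1) * z ^ S n)%C.
    rewrite (Cpow_S z n); ring.
Qed.

Lemma is_derive_egf (s : nat -> R) (N : nat) (z : C) :
  is_derive (V := C_self)
    (egf s (S N)) z (egf (shift s) N z).
Proof.
assert (Hterm : forall k : nat, is_derive (V := C_self)
  (fun x : C => (RtoC (s (S k)) * (x ^ S k / RtoC (INR (fact (S k)))))%C) z
  (RtoC (shift s k) * (z ^ k / RtoC (INR (fact k))))%C).
{ intros k.
  apply (is_derive_ext (V := C_self)
    (fun x : C => (x ^ S k * (RtoC (s (S k)) / RtoC (INR (fact (S k)))))%C)).
  { assert (E : forall a b x : C, (x ^ S k * (a / b) = a * (x ^ S k / b))%C)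
      by (intros; unfold Cdiv; ring).
    intros x; apply E. }
  replace (RtoC (shift s k) * (z ^ k / RtoC (INR (fact k))))%C
    with (RtoC (INR (S k)) * z ^ k * (RtoC (s (S k)) / RtoC (INR (fact (S k)))))%C.
  - exact (is_derive_scal_l (V := C_self) (fun x : C => (x ^ S k)%C) z _ _
      (is_derive_Cpow k z)).
  - unfold shift; rewrite RtoC_fact_S; field; split;
    [apply RtoC_fact_neq_0 | apply RtoC_INR_S_neq_0]. }
induction N as [|N IH].
- apply (is_derive_ext (V := C_self) (fun x : C => (RtoC (s 0%nat)
    + RtoC (s 1%nat) * (x ^ 1 / RtoC (INR (fact 1))))%C)).
  { intros x; rewrite egf_S, egf_0; reflexivity. }
  replace (egf (shift s) 0 z)
    with (RtoC 0 + RtoC (shift s 0%nat) * (z ^ 0 / RtoC (INR (fact 0))))%C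
    by (rewrite egf_0; simpl; field).
  apply (is_derive_plus (K := C_AbsRing) (V := C_self) (fun _ : C => RtoC (s 0%nat))).
  + apply (is_derive_const (K := C_AbsRing) (V := C_self)).
  + apply Hterm.
- apply (is_derive_ext (V := C_self) (fun x : C => (egf s (S N) x
    + RtoC (s (S (S N))) * (x ^ S (S N) / RtoC (INR (fact (S (S N))))))%C)).
  { intros x; now rewrite (egf_S s (S N)). }
  rewrite egf_S.
  now apply (is_derive_plus (K := C_AbsRing) (V := C_self)
    (egf s (S N))).
Qed.

(** Differentiation lowers the truncation to [N - 1]; the vanishing coefficient [s (S N)] allows it
    to be kept at [N], so that a polynomial and its derivatives share one bound. *)
Lemma Cdiff_egf (s : nat -> R) (N : nat) (z : C) :
  s (S N) = 0 -> Cdiff (egf s N) z (egf (shift s) N z).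
Proof.
intros Hs; destruct N as [|N].
- rewrite egf_0; unfold shift; rewrite Hs.
  intros eps Heps; exists 1; split; [lra|]; intros y _; rewrite !egf_0.
  replace (_ - _ - _)%C with (RtoC 0) by ring.
  rewrite Cmod_0; apply Rmult_le_pos; [lra|apply Cmod_ge_0].
- apply is_derive_Cdiff.
  replace (egf (shift s) (S N) z) with (egf (shift s) N z); [apply is_derive_egf|].
  rewrite egf_S; unfold shift at 3; rewrite Hs; ring.
Qed.

Definition Ccont (f : C -> C) (z : C) : Prop :=
  forall eps : R, 0 < eps -> exists d : R, 0 < d /\
    forall y : C, Cmod (y - z) < d -> Cmod (f y - f z) < eps.

Lemma Cdiff_Ccont (f : C -> C) (z l : C) : Cdiff f z l -> Ccont f z.
Proof.
intros H eps Heps; destruct (H 1 Rlt_0_1) as [d [Hd Hf]].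
pose proof (Cmod_ge_0 l) as Hl.
assert (He : 0 < eps / (Cmod l + 1)) by (apply Rdiv_lt_0_compat; lra).
exists (Rmin d (eps / (Cmod l + 1))); split; [now apply Rmin_pos|].
intros y Hy.
assert (Hy1 := Rlt_le_trans _ _ _ Hy (Rmin_l _ _)).
assert (Hy2 := Rlt_le_trans _ _ _ Hy (Rmin_r _ _)).
specialize (Hf y Hy1).
replace (f y - f z)%C with ((f y - f z - (y - z) * l) + (y - z) * l)%C by ring.
eapply Rle_lt_trans; [apply Cmod_triangle|]; rewrite Cmod_mult.
apply Rle_lt_trans with (Cmod (y - z) * (Cmod l + 1)); [lra|].
replace eps with (eps / (Cmod l + 1) * (Cmod l + 1)) by (field; lra).
apply Rmult_lt_compat_r; lra.
Qed.

Lemma Ccont_div (f g : C -> C) (z : C) :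
  Ccont f z -> Ccont g z -> g z <> RtoC 0 -> Ccont (fun y => f y / g y)%C z.
Proof.
intros Hf Hg Hz eps Heps.
assert (Hb : 0 < Cmod (g z)) by now apply Cmod_gt_0.
set (b := Cmod (g z)) in *; set (a := Cmod (f z)).
assert (Ha : 0 <= a) by apply Cmod_ge_0.
(* Chosen so that [e (a + b)], which bounds the numerator of the difference of quotients, is half of
   [eps] times the lower bound [b (b / 2)] of the denominator. *)
pose (e := eps * (b * (b / 2)) / (2 * (a + b))).
assert (He : 0 < e).
{ apply Rdiv_lt_0_compat; [|lra].
  apply Rmult_lt_0_compat; [lra|]; apply Rmult_lt_0_compat; lra. }
destruct (Hf e He) as [d1 [Hd1 H1]].
destruct (Hg (Rmin e (b / 2))) as [d2 [Hd2 H2]]; [apply Rmin_pos; lra|].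
exists (Rmin d1 d2); split; [now apply Rmin_pos|]; intros y Hy.
specialize (H1 y (Rlt_le_trans _ _ _ Hy (Rmin_l _ _))).
specialize (H2 y (Rlt_le_trans _ _ _ Hy (Rmin_r _ _))).
assert (H3 := Rlt_le_trans _ _ _ H2 (Rmin_l _ _)).
assert (H4 := Rlt_le_trans _ _ _ H2 (Rmin_r _ _)).
assert (Hgy : b / 2 < Cmod (g y)).
{ assert (b <= Cmod (g y) + Cmod (g y - g z)); [|lra].
  unfold b; replace (g z) with (g y + - (g y - g z))%C at 1 by ring.
  rewrite <- (Cmod_opp (g y - g z)); apply Cmod_triangle. }
assert (Hgy0 : g y <> RtoC 0) by (apply Cmod_gt_0; lra).
replace (f y / g y - f z / g z)%C
  with (((f y - f z) * g z + - (f z * (g y - g z))) / (g y * g z))%C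
  by (field; now split).
rewrite Cmod_div by now apply Cmult_neq_0.
rewrite Cmod_mult; fold b.
assert (Hden : b * (b / 2) < Cmod (g y) * b) by nra.
assert (Hden0 : 0 < b * (b / 2)) by nra.
apply (Rmult_lt_reg_r (Cmod (g y) * b)); [lra|].
unfold Rdiv; rewrite Rmult_assoc, Rinv_l, Rmult_1_r by lra.
apply Rle_lt_trans with (e * (a + b)).
- eapply Rle_trans; [apply Cmod_triangle|].
  rewrite Cmod_opp, !Cmod_mult; fold a b; nra.
- apply Rlt_trans with (eps * (b * (b / 2))).
  + unfold e; apply Rlt_0_minus.
    replace (_ - _) with (eps * (b * (b / 2)) / 2) by (field; lra).
    apply Rdiv_lt_0_compat; [|lra]; apply Rmult_lt_0_compat; lra.
  + apply Rmult_lt_compat_l; lra.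
Qed.

(** * Integration along segments *)

Lemma im_le_Cmod (c : C) : Rabs (Im c) <= Cmod c.
Proof. exact (Rle_trans _ _ _ (Rmax_r _ _) (Rmax_Cmod c)). Qed.

Definition segment (z h : C) (t : R) : C := (z + RtoC t * h)%C.

Lemma segment_dist (z h : C) (t t' : R) :
  Cmod (segment z h t' - segment z h t) = Rabs (t' - t) * Cmod h.
Proof.
unfold segment; rewrite <- Cmod_R, <- Cmod_mult; f_equal.
rewrite RtoC_minus; ring.
Qed.

Lemma segment_near (z h : C) (t d : R) : 0 < d ->
  exists d' : posreal, forall t' : R, Rabs (t' - t) < d' ->
    Cmod (segment z h t' - segment z h t) < d.
Proof.
intros Hd; pose proof (Cmod_ge_0 h) as Hh.
assert (Hp : 0 < d / (Cmod h + 1)) by (apply Rdiv_lt_0_compat; lra).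
exists (mkposreal _ Hp); simpl; intros t' Ht'; rewrite segment_dist.
pose proof (Rabs_pos (t' - t)).
apply Rle_lt_trans with (Rabs (t' - t) * (Cmod h + 1)); [nra|].
apply Rlt_le_trans with (d / (Cmod h + 1) * (Cmod h + 1)).
- apply Rmult_lt_compat_r; lra.
- right; field; lra.
Qed.

Lemma segment_in_disc (z h : C) (t : R) :
  unit_disc z -> unit_disc (z + h) -> 0 <= t <= 1 -> unit_disc (segment z h t).
Proof.
unfold unit_disc, segment; intros Hz Hzh Ht.
replace (z + RtoC t * h)%C with (RtoC (1 - t) * z + RtoC t * (z + h))%C
  by (rewrite RtoC_minus; ring).
eapply Rle_lt_trans; [apply Cmod_triangle|].
rewrite !Cmod_mult, !Cmod_R, !Rabs_pos_eq by lra.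
pose proof (Cmod_ge_0 z); pose proof (Cmod_ge_0 (z + h)).
(* Strictness comes from whichever of the weights [1 - t] and [t] is at least 1/2. *)
destruct (Rle_lt_dec t (1 / 2)); nra.
Qed.

Lemma segment_locally_in_disc (z h : C) (t : R) :
  unit_disc (segment z h t) ->
  locally t (fun t' => unit_disc (segment z h t')).
Proof.
unfold unit_disc; intros Ht.
destruct (segment_near z h t (1 - Cmod (segment z h t))) as [d Hd]; [lra|].
exists d; intros t' Ht'.
assert (H := Hd t' Ht').
replace (segment z h t')
  with (segment z h t + (segment z h t' - segment z h t))%C by ring.
eapply Rle_lt_trans; [apply Cmod_triangle|]; lra.
Qed.

Lemma continuous_segment (q : C -> C) (z h : C) (t : R) :
  Ccont q (segment z h t) ->
  continuous (fun x : R => Re (q (segment z h x))) t /\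
  continuous (fun x : R => Im (q (segment z h x))) t.
Proof.
intros Hq; split; intros P [eps HP];
  destruct (Hq eps (cond_pos eps)) as [d [Hd Hqd]];
  destruct (segment_near z h t d Hd) as [d' Hd'];
  exists d'; intros t' Ht'; apply HP;
  specialize (Hqd _ (Hd' t' Ht'));
  (eapply Rle_lt_trans; [|exact Hqd]).
- exact (re_le_Cmod (q (segment z h t') - q (segment z h t))).
- exact (im_le_Cmod (q (segment z h t') - q (segment z h t))).
Qed.

Lemma is_derive_segment (f : C -> C) (z h l : C) (t : R) :
  Cdiff f (segment z h t) l ->
  is_derive (fun x : R => Re (f (segment z h x))) t (Re (h * l)) /\
  is_derive (fun x : R => Im (f (segment z h x))) t (Im (h * l)).
Proof.
intros Hf.
assert (H : forall eps : posreal, locally t (fun y : R =>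
  Cmod (f (segment z h y) - f (segment z h t) - RtoC (y - t) * (h * l))
  <= eps * Rabs (y - t))).
{ intros eps; pose proof (Cmod_ge_0 h) as Hh.
  assert (Hp : 0 < eps / (Cmod h + 1))
    by (apply Rdiv_lt_0_compat; [apply cond_pos|lra]).
  destruct (Hf _ Hp) as [d [Hd Hfd]].
  destruct (segment_near z h t d Hd) as [d' Hd'].
  exists d'; intros t' Ht'; specialize (Hfd _ (Hd' t' Ht')).
  rewrite segment_dist in Hfd.
  replace (RtoC (t' - t) * (h * l))%C
    with ((segment z h t' - segment z h t) * l)%C
    by (unfold segment; rewrite RtoC_minus; ring).
  eapply Rle_trans; [exact Hfd|].
  replace (eps * Rabs (t' - t))
    with (eps / (Cmod h + 1) * (Rabs (t' - t) * (Cmod h + 1)))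
    by (field; lra).
  pose proof (Rabs_pos (t' - t)).
  apply Rmult_le_compat_l; nra. }
split; (split; [apply is_linear_scal_l|]); intros x Hx;
  rewrite <- (is_filter_lim_locally_unique _ _ Hx);
  intros eps; generalize (H eps); apply filter_imp; intros y Hy;
  (eapply Rle_trans; [|exact Hy]);
  set (u := f (segment z h y)); set (v := f (segment z h t)); set (k := (h * l)%C).
- replace (norm _) with (Rabs (Re (u - v - RtoC (y - t) * k))).
  + apply re_le_Cmod.
  + unfold norm; simpl; unfold abs; simpl; f_equal.
    unfold minus, plus, opp, scal; simpl; unfold mult, Re, Im; simpl; ring.
- replace (norm _) with (Rabs (Im (u - v - RtoC (y - t) * k))).
  + apply im_le_Cmod.
  + unfold norm; simpl; unfold abs; simpl; f_equal.
    unfold minus, plus, opp, scal; simpl; unfold mult, Re, Im; simpl; ring.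
Qed.

(** The path integral of [q] from [z] to [z + h], with [dz = h dt]; it is split into components so
    that the real fundamental theorem applies. *)
Definition segment_int (q : C -> C) (z h : C) : C :=
  (RInt (fun t : R => Re (h * q (segment z h t))) 0 1,
   RInt (fun t : R => Im (h * q (segment z h t))) 0 1).

Lemma Ccont_scal (q : C -> C) (h z : C) :
  Ccont q z -> Ccont (fun y => h * q y)%C z.
Proof.
intros Hq eps Heps; pose proof (Cmod_ge_0 h) as Hh.
destruct (Hq (eps / (Cmod h + 1))) as [d [Hd H]];
  [apply Rdiv_lt_0_compat; lra|].
exists d; split; [exact Hd|]; intros y Hy; specialize (H y Hy).
replace (h * q y - h * q z)%C with (h * (q y - q z))%C by ring.
rewrite Cmod_mult; pose proof (Cmod_ge_0 (q y - q z)).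
apply Rle_lt_trans with (Cmod (q y - q z) * (Cmod h + 1)); [nra|].
replace eps with (eps / (Cmod h + 1) * (Cmod h + 1)) by (field; lra).
apply Rmult_lt_compat_r; lra.
Qed.

(** Used with [c = 0] to bound the logarithm and with [c = h * q z] to differentiate it. Estimating
    the components separately would cost a factor [sqrt 2] and spoil [|w(z)| <= |z|], so the
    integrand is treated as one function into a module whose norm is [Cmod]. *)
Lemma segment_int_dist (q : C -> C) (z h c : C) (K : R) :
  unit_disc z -> unit_disc (z + h) ->
  (forall y : C, unit_disc y -> Ccont q y) ->
  (forall t : R, 0 <= t <= 1 -> Cmod (h * q (segment z h t) - c) <= K) ->
  Cmod (segment_int q z h - c) <= K.
Proof.
intros Hz Hzh Hq HK.
assert (Hc : forall t : R, 0 <= t <= 1 ->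
  continuous (fun x : R => Re (h * q (segment z h x))) t /\
  continuous (fun x : R => Im (h * q (segment z h x))) t).
{ intros t Ht; apply (continuous_segment (fun y => h * q y)%C).
  now apply Ccont_scal, Hq, segment_in_disc. }
set (phi := fun t : R => (h * q (segment z h t) - c)%C).
assert (Hint : is_RInt (V := C_R_NormedModule) phi 0 1 (segment_int q z h - c)%C).
{ assert (Hre : ex_RInt (fun x : R => Re (h * q (segment z h x))) 0 1).
  { apply (ex_RInt_continuous (V := R_CompleteNormedModule)).
    rewrite Rmin_left, Rmax_right by lra; intros; now apply Hc. }
  assert (Him : ex_RInt (fun x : R => Im (h * q (segment z h x))) 0 1).
  { apply (ex_RInt_continuous (V := R_CompleteNormedModule)).
    rewrite Rmin_left, Rmax_right by lra; intros; now apply Hc. }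
  assert (E1 := is_RInt_minus _ _ _ _ _ _ (RInt_correct _ _ _ Hre)
    (is_RInt_const 0 1 (Re c))).
  assert (E2 := is_RInt_minus _ _ _ _ _ _ (RInt_correct _ _ _ Him)
    (is_RInt_const 0 1 (Im c))).
  assert (E := is_RInt_fct_extend_pair (U := R_NormedModule)
    (V := R_NormedModule) phi 0 1 _ _ E1 E2).
  match type of E with is_RInt _ _ _ ?l =>
    replace (segment_int q z h - c)%C with l; [exact E|] end.
  unfold segment_int, minus, plus, opp, scal; simpl; unfold mult; simpl.
  unfold Cminus, Cplus, Copp; simpl; f_equal; unfold Re, Im; ring. }
rewrite Cmod_norm; replace K with ((1 - 0) * K) by ring.
apply (norm_RInt_le_const (V := C_R_NormedModule) phi 0 1); [lra| |exact Hint].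
intros t Ht.
apply Rle_trans with (Cmod (phi t)); [right; symmetry; apply Cmod_norm|].
now apply HK.
Qed.

(** * The complex exponential *)

Lemma Cexp_plus (a b : C) : Cexp (a + b) = (Cexp a * Cexp b)%C.
Proof.
destruct a as [a1 a2], b as [b1 b2]; unfold Cexp; simpl.
rewrite exp_plus, cos_plus, sin_plus.
unfold Cmult, Cplus, RtoC, Ci; simpl; f_equal; ring.
Qed.

Lemma cos_eq_1_small (d : R) : cos d = 1 -> Rabs d < 2 * PI -> d = 0.
Proof.
intros Hd Hlt.
assert (Hs : sin (d / 2) = 0).
{ replace d with (2 * (d / 2)) in Hd by field.
  rewrite cos_2a_sin in Hd; nra. }
destruct (Rabs_def2 _ _ Hlt) as [H1 H2].
destruct (Rtotal_order (d / 2) 0) as [H|[H|H]]; [| lra |].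
- assert (0 < sin (- (d / 2))) by (apply sin_gt_0; lra).
  rewrite sin_neg in *; lra.
- assert (0 < sin (d / 2)) by (apply sin_gt_0; lra); lra.
Qed.

(** Comparing moduli gives equal real parts; the angles then have the same cosine and sine, so the
    cosine of their difference is 1. *)
Lemma Cexp_inj (a b : C) :
  Cexp a = Cexp b -> Rabs (Im a - Im b) < 2 * PI -> a = b.
Proof.
destruct a as [a1 a2], b as [b1 b2]; unfold Cexp; simpl; intros H Hlt.
unfold Cmult, Cplus, RtoC, Ci in H; simpl in H; injection H as E1 E2.
ring_simplify in E1; ring_simplify in E2.
pose proof (exp_pos a1); pose proof (exp_pos b1).
assert (Hexp : exp a1 = exp b1).
{ pose proof (sin2_cos2 a2) as Ha; pose proof (sin2_cos2 b2) as Hb.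
  unfold Rsqr in *.
  assert (exp a1 * exp a1 = exp b1 * exp b1); [|nra].
  transitivity ((exp a1 * cos a2) * (exp a1 * cos a2)
    + (exp a1 * sin a2) * (exp a1 * sin a2)).
  - replace (_ + _) with
      (exp a1 * exp a1 * (sin a2 * sin a2 + cos a2 * cos a2)) by ring.
    rewrite Ha; ring.
  - rewrite E1, E2.
    replace (_ + _) with
      (exp b1 * exp b1 * (sin b2 * sin b2 + cos b2 * cos b2)) by ring.
    rewrite Hb; ring. }
assert (Hc : cos a2 = cos b2).
{ apply (Rmult_eq_reg_l (exp a1)); [|lra]; rewrite E1; now rewrite Hexp. }
assert (Hs : sin a2 = sin b2).
{ apply (Rmult_eq_reg_l (exp a1)); [|lra]; rewrite E2; now rewrite Hexp. }
f_equal; [now apply exp_inv|].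
apply Rminus_diag_uniq, cos_eq_1_small; [|exact Hlt].
rewrite cos_minus, Hc, Hs; pose proof (sin2_cos2 b2); unfold Rsqr in *; lra.
Qed.

(** * Logarithms in the disc *)

(** The parameter may be any [t] whose point lies in the disc: at [t = 0] and [t = 1] the two-sided
    derivative needs the integral slightly beyond [0, 1], and the disc is open. *)
Lemma is_derive_RInt_segment (q : C -> C) (z h : C) (t : R) :
  unit_disc z -> unit_disc (segment z h t) ->
  (forall y : C, unit_disc y -> Ccont q y) ->
  is_derive (RInt (fun x => Re (h * q (segment z h x))) 0) t
    (Re (h * q (segment z h t))) /\
  is_derive (RInt (fun x => Im (h * q (segment z h x))) 0) t
    (Im (h * q (segment z h t))).
Proof.
intros Hz Ht Hq.
assert (Hc : forall x : R, unit_disc (segment z h x) ->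
  continuous (fun x : R => Re (h * q (segment z h x))) x /\
  continuous (fun x : R => Im (h * q (segment z h x))) x).
{ intros x Hx; apply (continuous_segment (fun y => h * q y)%C).
  now apply Ccont_scal, Hq. }
assert (Hin : forall x y : R, unit_disc (segment z h x) ->
  Rmin 0 x <= y <= Rmax 0 x -> unit_disc (segment z h y)).
{ intros x y Hx Hy; unfold segment in Hx.
  destruct (Req_dec x 0) as [->|Hx0].
  - rewrite Rmin_left, Rmax_left in Hy by lra; replace y with 0 by lra.
    exact Hx.
  (* A point between parameters 0 and [x], with [x] of either sign, lies on the segment of direction
     [x h] at parameter [y / x] in [0, 1], so convexity applies. *)
  - replace (segment z h y) with (segment z (RtoC x * h) (y / x)).
    + apply segment_in_disc; [exact Hz|exact Hx|].
      destruct (Rle_lt_dec x 0) as [H|H];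
        [rewrite Rmin_right, Rmax_left in Hy by lra
        |rewrite Rmin_left, Rmax_right in Hy by lra].
      * replace (y / x) with ((- y) / (- x)) by (field; lra); split;
          [apply Rle_mult_inv_pos; lra|].
        apply (Rmult_le_reg_r (- x)); [lra|]; unfold Rdiv.
        rewrite Rmult_assoc, Rinv_l; lra.
      * split; [apply Rle_mult_inv_pos; lra|].
        apply (Rmult_le_reg_r x); [lra|]; unfold Rdiv.
        rewrite Rmult_assoc, Rinv_l; lra.
    + unfold segment; rewrite Cmult_assoc, <- RtoC_mult; do 3 f_equal.
      field; exact Hx0. }
assert (Hder : forall g : R -> R,
  (forall x : R, unit_disc (segment z h x) -> continuous g x) ->
  is_derive (RInt g 0) t (g t)).
{ intros g Hg; apply (is_derive_RInt (V := R_NormedModule) g _ 0); [|now apply Hg].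
  generalize (segment_locally_in_disc z h t Ht); apply filter_imp; intros x Hx.
  apply (RInt_correct (V := R_CompleteNormedModule)).
  apply (ex_RInt_continuous (V := R_CompleteNormedModule)).
  intros y Hy; apply Hg; now apply (Hin x). }
split; apply Hder; intros x Hx; now apply Hc.
Qed.

(** With [F = u + i v] the system is [F' = (g + i k) F], and [exp (-(A + i B)) F] is constant. [HP]
    and [HQ] are the real and imaginary parts of this constancy. *)
Lemma linear_system_solution (A B u v g k : R -> R) :
  (forall t : R, 0 <= t <= 1 ->
    is_derive A t (g t) /\ is_derive B t (k t) /\
    is_derive u t (g t * u t - k t * v t) /\
    is_derive v t (g t * v t + k t * u t)) ->
  A 0 = 0 -> B 0 = 0 ->
  u 1 = exp (A 1) * (u 0 * cos (B 1) - v 0 * sin (B 1)) /\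
  v 1 = exp (A 1) * (u 0 * sin (B 1) + v 0 * cos (B 1)).
Proof.
intros Hd HA0 HB0.
assert (Hder : forall (f : R -> R) (t l : R),
  is_derive f t l -> Derive (fun x : R => f x) t = l)
  by exact is_derive_unique.
assert (HP : exp (- A 0) * (u 0 * cos (B 0) + v 0 * sin (B 0))
  = exp (- A 1) * (u 1 * cos (B 1) + v 1 * sin (B 1))).
{ apply (eq_is_derive (V := R_NormedModule)
    (fun t => exp (- A t) * (u t * cos (B t) + v t * sin (B t)))); [|lra].
  intros t Ht; destruct (Hd t Ht) as (HA & HB & Hu & Hv).
  auto_derive.
  - repeat split; eexists; eassumption.
  - rewrite (Hder A _ _ HA), (Hder B _ _ HB), (Hder u _ _ Hu), (Hder v _ _ Hv).
    unfold zero; simpl; ring. }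
assert (HQ : exp (- A 0) * (v 0 * cos (B 0) - u 0 * sin (B 0))
  = exp (- A 1) * (v 1 * cos (B 1) - u 1 * sin (B 1))).
{ apply (eq_is_derive (V := R_NormedModule)
    (fun t => exp (- A t) * (v t * cos (B t) - u t * sin (B t)))); [|lra].
  intros t Ht; destruct (Hd t Ht) as (HA & HB & Hu & Hv).
  auto_derive.
  - repeat split; eexists; eassumption.
  - rewrite (Hder A _ _ HA), (Hder B _ _ HB), (Hder u _ _ Hu), (Hder v _ _ Hv).
    unfold zero; simpl; ring. }
rewrite HA0, HB0, Ropp_0, exp_0, cos_0, sin_0 in HP, HQ.
rewrite !Rmult_0_r, !Rmult_1_r, !Rmult_1_l in HP, HQ.
rewrite Rplus_0_r in HP; rewrite Rminus_0_r in HQ.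
pose proof (sin2_cos2 (B 1)) as Hsc; unfold Rsqr in Hsc.
assert (He : exp (A 1) * exp (- A 1) = 1)
  by (rewrite <- exp_plus, Rplus_opp_r; apply exp_0).
rewrite HP, HQ; split.
- transitivity (u 1 * (exp (A 1) * exp (- A 1))
    * (sin (B 1) * sin (B 1) + cos (B 1) * cos (B 1))).
  + rewrite He, Hsc; ring.
  + ring.
- transitivity (v 1 * (exp (A 1) * exp (- A 1))
    * (sin (B 1) * sin (B 1) + cos (B 1) * cos (B 1))).
  + rewrite He, Hsc; ring.
  + ring.
Qed.

(** Along the segment, [F(t) = f (z + t h)] solves the scalar linear equation [F' = (h q) F], so no
    logarithm of [f] has to be chosen. *)
Lemma exp_segment_int (f q : C -> C) (z h : C) :
  unit_disc z -> unit_disc (z + h) ->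
  (forall y : C, unit_disc y -> Cdiff f y (q y * f y)%C) ->
  (forall y : C, unit_disc y -> Ccont q y) ->
  f (z + h)%C = (f z * Cexp (segment_int q z h))%C.
Proof.
intros Hz Hzh Hf Hq.
set (g := fun x => Re (h * q (segment z h x))).
set (k := fun x => Im (h * q (segment z h x))).
set (u := fun x => Re (f (segment z h x))).
set (v := fun x => Im (f (segment z h x))).
assert (Hd : forall t : R, 0 <= t <= 1 ->
  is_derive (RInt g 0) t (g t) /\ is_derive (RInt k 0) t (k t) /\
  is_derive u t (g t * u t - k t * v t) /\
  is_derive v t (g t * v t + k t * u t)).
{ intros t Ht.
  assert (Hs := segment_in_disc z h t Hz Hzh Ht).
  destruct (is_derive_RInt_segment q z h t Hz Hs Hq) as [H1 H2].
  destruct (is_derive_segment f z h _ t (Hf _ Hs)) as [H3 H4].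
  rewrite Cmult_assoc in H3, H4.
  split; [exact H1|]; split; [exact H2|]; split; [exact H3|].
  replace (g t * v t + k t * u t)
    with (Im (h * q (segment z h t) * f (segment z h t)));
    [exact H4|unfold g, k, u, v; reflexivity]. }
destruct (linear_system_solution (RInt g 0) (RInt k 0) u v g k Hd
  (RInt_point 0 g) (RInt_point 0 k)) as [Hu Hv].
assert (E0 : segment z h 0 = z) by (unfold segment; ring).
assert (E1 : segment z h 1 = (z + h)%C) by (unfold segment; ring).
unfold u, v in Hu, Hv; rewrite E0, E1 in Hu, Hv.
change (segment_int q z h) with (RInt g 0 1, RInt k 0 1).
revert Hu Hv; generalize (RInt g 0 1) (RInt k 0 1); intros a b Hu Hv.
apply injective_projections;
  [eapply eq_trans; [exact Hu|] | eapply eq_trans; [exact Hv|]];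
  unfold Cexp, Cmult, Cplus, RtoC, Ci, Re, Im; simpl; ring.
Qed.

Lemma segment_int_bound (q : C -> C) (z h : C) :
  unit_disc z -> unit_disc (z + h) ->
  (forall y : C, unit_disc y -> Ccont q y) ->
  (forall y : C, unit_disc y -> Cmod (q y) <= 1) ->
  Cmod (segment_int q z h) <= Cmod h.
Proof.
intros Hz Hzh Hq Hb.
replace (segment_int q z h) with (segment_int q z h - RtoC 0)%C by ring.
apply segment_int_dist; try assumption.
intros t Ht; replace (h * _ - RtoC 0)%C with (h * q (segment z h t))%C by ring.
rewrite Cmod_mult; pose proof (Cmod_ge_0 h).
specialize (Hb _ (segment_in_disc z h t Hz Hzh Ht)); nra.
Qed.

(* The logarithm is the integral of f'/f along radii; two of its values differ
   by the integral along the chord, because both exponentiate to the same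
   quotient of values of f and their imaginary parts are less than 2 PI apart. *)
Lemma subordinate_exp_of_logderiv (f q : C -> C) :
  f (RtoC 0) = RtoC 1 ->
  (forall y : C, unit_disc y -> Cdiff f y (q y * f y)%C) ->
  (forall y : C, unit_disc y -> Ccont q y) ->
  (forall y : C, unit_disc y -> Cmod (q y) <= 1) ->
  subordinate f Cexp.
Proof.
intros Hf0 Hf Hq Hb.
set (w := segment_int q (RtoC 0)).
assert (H0 : unit_disc (RtoC 0)) by (unfold unit_disc; rewrite Cmod_0; lra).
assert (Hw : forall z, unit_disc z -> Cmod (w z) <= Cmod z).
{ intros z Hz; apply segment_int_bound; try assumption.
  now rewrite Cplus_0_l. }
assert (Hfw : forall z, unit_disc z -> f z = Cexp (w z)).
{ intros z Hz; assert (E := exp_segment_int f q (RtoC 0) z H0).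
  rewrite Cplus_0_l, Hf0, Cmult_1_l in E; now apply E. }
assert (Hadd : forall z y, unit_disc z -> unit_disc y ->
  (w y - w z)%C = segment_int q z (y - z)).
{ intros z y Hz Hy.
  assert (Ey : (z + (y - z))%C = y) by ring.
  assert (Hzy : unit_disc (z + (y - z))) by now rewrite Ey.
  assert (E := exp_segment_int f q z (y - z) Hz Hzy Hf Hq).
  rewrite Ey, !Hfw, <- Cexp_plus in E by assumption.
  apply Cexp_inj in E; [rewrite E; ring|].
  pose proof (segment_int_bound q z (y - z) Hz Hzy Hq Hb) as H1.
  pose proof (Hw z Hz) as H2; pose proof (Hw y Hy) as H3.
  assert (H4 : Cmod (y - z) <= Cmod y + Cmod z).
  { rewrite <- (Cmod_opp z); apply Cmod_triangle. }
  pose proof (im_le_Cmod (w y - (w z + segment_int q z (y - z)))) as H5.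
  assert (H6 : Cmod (w y - (w z + segment_int q z (y - z)))
    <= Cmod (w y) + (Cmod (w z) + Cmod (segment_int q z (y - z)))).
  { eapply Rle_trans; [apply Cmod_triangle|]; rewrite Cmod_opp.
    apply Rplus_le_compat_l, Cmod_triangle. }
  pose proof PI2_1; unfold unit_disc in *.
  (* [|w y|] and [|w z|] are below 1 and the chord integral is at most [|y| + |z| < 2], for a total
     below 4. *)
  apply Rle_lt_trans with (2 := ltac:(lra) : 4 < 2 * PI).
  eapply Rle_trans; [exact H5|]; lra. }
exists w; repeat split.
- intros z Hz; exists (q z); apply Cdiff_is_derive; intros eps Heps.
  destruct (Hq z Hz eps Heps) as [d [Hd Hqd]].
  unfold unit_disc in Hz.
  exists (Rmin d (1 - Cmod z)); split; [apply Rmin_pos; lra|].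
  intros y Hy.
  assert (Hy1 := Rlt_le_trans _ _ _ Hy (Rmin_l _ _)).
  assert (Hy2 := Rlt_le_trans _ _ _ Hy (Rmin_r _ _)).
  assert (Ey : (z + (y - z))%C = y) by ring.
  assert (Hyd : unit_disc y).
  { unfold unit_disc; rewrite <- Ey.
    eapply Rle_lt_trans; [apply Cmod_triangle|]; lra. }
  (* The error [w y - w z - (y - z) q z] is the integral of [q - q z] along the chord, all of whose
     points are within [d] of [z]. *)
  rewrite Hadd by assumption.
  apply segment_int_dist; [assumption|now rewrite Ey|assumption|].
  intros t Ht.
  replace (_ - _)%C with ((y - z) * (q (segment z (y - z) t) - q z))%C by ring.
  rewrite Cmod_mult, Rmult_comm; apply Rmult_le_compat_r; [apply Cmod_ge_0|].
  left; apply Hqd.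
  assert (E := segment_dist z (y - z) 0 t).
  replace (segment z (y - z) 0) with z in E by (unfold segment; ring).
  rewrite E, Rminus_0_r, Rabs_pos_eq by lra.
  pose proof (Cmod_ge_0 (y - z)); nra.
- apply Cmod_eq_0; specialize (Hw _ H0); rewrite Cmod_0 in Hw.
  pose proof (Cmod_ge_0 (w (RtoC 0))); lra.
- intros z Hz; specialize (Hw z Hz); unfold unit_disc in Hz; lra.
- exact Hfw.
Qed.

(** * Euler's integral *)

(** For a nonnegative integrand the integrals grow with the interval, so they converge to their
    supremum [l]. The bound by the integral over [1, 2] later yields positivity of Gamma. *)
Lemma is_RInt_gen_bounded (f : R -> R) (L : R) :
  (forall x : R, 0 < x -> continuous f x) ->
  (forall x : R, 0 < x -> 0 <= f x) ->
  (forall x y : R, 0 < x -> x <= y -> RInt f x y <= L) ->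
  exists l : R, is_RInt_gen f (at_right 0) (Rbar_locally p_infty) l /\
    RInt f 1 2 <= l.
Proof.
intros Hc Hpos HL.
assert (Hex : forall x y, 0 < x -> 0 < y -> ex_RInt f x y).
{ intros x y Hx Hy; apply (ex_RInt_continuous (V := R_CompleteNormedModule)).
  intros t Ht; apply Hc; pose proof (Rmin_pos x y Hx Hy); lra. }
set (E := fun v => exists x y, 0 < x /\ x <= y /\ v = RInt f x y).
destruct (completeness E) as [l [Hub Hlub]].
- exists L; intros v (x & y & Hx & Hxy & ->); now apply HL.
- exists (RInt f 1 2), 1, 2; repeat split; lra.
- exists l; split; [|apply Hub; exists 1, 2; repeat split; lra].
  intros P [eps HP].
  assert (Happ : exists x y, 0 < x /\ x <= y /\ l - eps < RInt f x y).
  { apply Classical_Prop.NNPP; intros Hn.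
    apply (Rlt_irrefl l), Rle_lt_trans with (l - eps);
      [|pose proof (cond_pos eps); lra].
    apply Hlub; intros v (x & y & Hx & Hxy & ->).
    apply Rnot_lt_le; intros Hlt; apply Hn; now exists x, y. }
  destruct Happ as (x0 & y0 & Hx0 & Hxy0 & Hl).
  apply (Filter_prod _ _ _ (fun x => 0 < x < x0) (fun y => y0 < y)).
  + exists (mkposreal x0 Hx0); intros x Hx Hx'; split; [exact Hx'|].
    change (Rabs (x - 0) < x0) in Hx; destruct (Rabs_def2 _ _ Hx); lra.
  + now exists y0.
  + intros x y [Hx Hxx] Hy; simpl.
    assert (HI : is_RInt f x y (RInt f x y)).
    { apply (RInt_correct (V := R_CompleteNormedModule)); apply Hex; lra. }
    exists (RInt f x y); split; [exact HI|]; apply HP.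
    assert (Hle : RInt f x y <= l)
      by (apply Hub; exists x, y; repeat split; lra).
    assert (Hge : RInt f x0 y0 <= RInt f x y).
    { assert (Hy0 : 0 < y0) by lra; assert (Hy' : 0 < y) by lra.
      assert (C1 := RInt_Chasles f x x0 y (Hex _ _ Hx Hx0) (Hex _ _ Hx0 Hy')).
      assert (C2 := RInt_Chasles f x0 y0 y (Hex _ _ Hx0 Hy0) (Hex _ _ Hy0 Hy')).
      unfold plus in C1, C2; simpl in C1, C2.
      assert (0 <= RInt f x x0).
      { apply RInt_ge_0; [lra|apply Hex; lra|intros; apply Hpos; lra]. }
      assert (0 <= RInt f y0 y).
      { apply RInt_ge_0; [lra|apply Hex; lra|intros; apply Hpos; lra]. }
      lra. }
    change (Rabs (RInt f x y - l) < eps); pose proof (cond_pos eps).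
    apply Rabs_def1; lra.
Qed.

Lemma exp_le (x y : R) : x <= y -> exp x <= exp y.
Proof.
intros [H| ->]; [left; now apply exp_increasing|apply Rle_refl].
Qed.

Definition Gamma_integrand (a t : R) : R := Rpower t (a - 1) * exp (- t).

(** Half of the exponential absorbs the power: [1 + ln x <= x] at [x = t / (2 p)], multiplied by
    [p = a - 1 > 0], gives [t^p <= (2 p)^p e^(t/2)]. *)
Lemma Gamma_integrand_bound (a : R) : 1 < a ->
  exists K : R, 0 < K /\
    forall t : R, 0 < t -> Gamma_integrand a t <= K * exp (- (t / 2)).
Proof.
intros Ha; set (p := a - 1); assert (Hp : 0 < p) by (unfold p; lra).
exists (exp (p * ln (2 * p))); split; [apply exp_pos|]; intros t Ht.
unfold Gamma_integrand, Rpower; fold p; rewrite <- !exp_plus.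
apply exp_le.
assert (Hq : 0 < t / (2 * p)) by (apply Rdiv_lt_0_compat; lra).
assert (H := exp_ineq1_le (ln (t / (2 * p)))).
rewrite exp_ln, ln_div in H by lra.
apply (Rmult_le_compat_l p) in H; [|lra].
replace (p * (t / (2 * p))) with (t / 2) in H by (field; lra).
lra.
Qed.

Lemma Gamma_integrand_pos (a t : R) : 0 < Gamma_integrand a t.
Proof. apply Rmult_lt_0_compat; apply exp_pos. Qed.

Lemma is_derive_Gamma_integrand (a t : R) : 0 < t ->
  is_derive (Gamma_integrand (a + 1)) t
    (a * Gamma_integrand a t - Gamma_integrand (a + 1) t).
Proof.
intros Ht; unfold Gamma_integrand.
replace (a + 1 - 1) with a by ring.
apply (is_derive_ext_loc (fun x => exp (a * ln x) * exp (- x))).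
{ now apply filter_forall. }
auto_derive; [exact Ht|].
replace (Rpower t (a - 1)) with (exp (a * ln t) / t).
- unfold Rpower; field; lra.
- unfold Rpower; replace ((a - 1) * ln t) with (a * ln t + - ln t) by ring.
  now rewrite exp_plus, exp_Ropp, exp_ln.
Qed.

Lemma Gamma_integrand_continuous (a t : R) : 0 < t ->
  continuous (Gamma_integrand a) t.
Proof.
intros Ht; apply (ex_derive_continuous (V := R_NormedModule)).
replace a with (a - 1 + 1) by ring.
eexists; now apply is_derive_Gamma_integrand.
Qed.

Lemma is_RInt_gen_Gamma (a : R) : 1 < a ->
  is_RInt_gen (Gamma_integrand a) (at_right 0) (Rbar_locally p_infty) (Gamma a)
  /\ 0 < Gamma a.
Proof.
intros Ha; destruct (Gamma_integrand_bound a Ha) as (K & HK & HfK).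
(* [2 K] is the integral of the majorant [K e^(-t/2)] over the half-line. *)
destruct (is_RInt_gen_bounded (Gamma_integrand a) (2 * K)) as (l & Hl & Hlp).
- apply Gamma_integrand_continuous.
- intros; left; apply Gamma_integrand_pos.
- intros x y Hx Hxy.
  assert (HI : is_RInt (fun t => K * exp (- (t / 2))) x y
    (- (2 * K * exp (- (y / 2))) - - (2 * K * exp (- (x / 2))))).
  { apply (is_RInt_derive (V := R_CompleteNormedModule)
      (fun t => - (2 * K * exp (- (t / 2))))).
    - intros t _; auto_derive; [easy|unfold Rdiv; field].
    - intros t _; apply (ex_derive_continuous (V := R_NormedModule)).
      now auto_derive. }
  apply Rle_trans with (RInt (fun t => K * exp (- (t / 2))) x y).
  + apply RInt_le; [exact Hxy| |now eexists; exact HI|intros; apply HfK; lra].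
    apply (ex_RInt_continuous (V := R_CompleteNormedModule)); intros t Ht.
    apply Gamma_integrand_continuous; rewrite Rmin_left in Ht; lra.
  + rewrite (is_RInt_unique _ _ _ _ HI).
    pose proof (exp_pos (- (y / 2))) as He.
    assert (Hx1 : exp (- (x / 2)) <= 1).
    { rewrite <- exp_0; apply exp_le; lra. }
    nra.
- assert (E : Gamma a = l).
  { exact (is_RInt_gen_unique (V := R_CompleteNormedModule) _ _ Hl). }
  rewrite E; split; [exact Hl|].
  apply Rlt_le_trans with (2 := Hlp).
  apply RInt_gt_0; [lra|intros; apply Gamma_integrand_pos|].
  intros; apply Gamma_integrand_continuous; lra.
Qed.

Lemma Gamma_integrand_lim_infty (a : R) : 1 < a ->
  filterlim (Gamma_integrand a) (Rbar_locally p_infty) (locally 0).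
Proof.
intros Ha; destruct (Gamma_integrand_bound a Ha) as (K & HK & HfK).
apply (filterlim_le_le (F := Rbar_locally p_infty) (fun _ => 0) _
  (fun t => K * exp (- (t / 2))) 0).
- exists 0; intros t Ht; split; [left; apply Gamma_integrand_pos|now apply HfK].
- apply filterlim_const.
- change (is_lim (fun t => K * exp (- (t / 2))) p_infty 0).
  replace (Finite 0) with (Rbar_mult K 0)
    by (simpl; f_equal; ring).
  apply is_lim_scal_l.
  apply (is_lim_comp exp (fun t => - (t / 2)) p_infty 0 m_infty).
  + apply is_lim_exp_m.
  + intros P [N HN]; exists (- 2 * N); intros t Ht; apply HN; lra.
  + now exists 0.
Qed.

Lemma Gamma_integrand_lim_0 (a : R) : 2 < a ->
  filterlim (Gamma_integrand a) (at_right 0) (locally 0).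
Proof.
intros Ha.
intros P [eps HP].
exists (mkposreal (Rmin 1 eps) (Rmin_pos _ _ Rlt_0_1 (cond_pos eps))).
intros t Ht Ht0; apply HP.
change (Rabs (t - 0) < Rmin 1 eps) in Ht; destruct (Rabs_def2 _ _ Ht).
pose proof (Rmin_l 1 eps); pose proof (Rmin_r 1 eps).
change (Rabs (Gamma_integrand a t - 0) < eps).
rewrite Rminus_0_r, Rabs_pos_eq by (left; apply Gamma_integrand_pos).
(* As [t < 1] and [a - 1 > 1], already [t^(a-1) <= t]. *)
apply Rle_lt_trans with t; [|lra].
assert (Hln : ln t < 0) by (rewrite <- ln_1; apply ln_increasing; lra).
unfold Gamma_integrand, Rpower; rewrite <- exp_plus.
rewrite <- (exp_ln t) at 3 by exact Ht0.
apply exp_le; nra.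
Qed.

(** Integration by parts: the derivative of [t^a e^(-t)] is [a t^(a-1) e^(-t) - t^a e^(-t)], and its
    integral [HD] is zero because both boundary limits vanish. *)
Lemma Gamma_S (a : R) : 1 < a -> Gamma (a + 1) = a * Gamma a.
Proof.
intros Ha; destruct (is_RInt_gen_Gamma a Ha) as [HI _].
assert (HD : is_RInt_gen (Derive (Gamma_integrand (a + 1)))
  (at_right 0) (Rbar_locally p_infty) (0 - 0)).
{ apply is_RInt_gen_Derive.
  - apply (Filter_prod _ _ _ (fun x => 0 < x) (fun y => 0 < y)).
    + now exists (mkposreal 1 Rlt_0_1).
    + now exists 0.
    + intros x y Hx Hy t Ht; simpl in Ht; pose proof (Rmin_pos x y Hx Hy).
      eexists; apply is_derive_Gamma_integrand; lra.
  - apply (Filter_prod _ _ _ (fun x => 0 < x) (fun y => 0 < y)).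
    + now exists (mkposreal 1 Rlt_0_1).
    + now exists 0.
    + intros x y Hx Hy t Ht; simpl in Ht; pose proof (Rmin_pos x y Hx Hy).
      assert (Ht0 : 0 < t) by lra.
      apply (continuous_ext_loc (T := R_UniformSpace) (U := R_UniformSpace) _
        (fun s => a * Gamma_integrand a s - Gamma_integrand (a + 1) s)).
      * generalize (locally_interval (fun s => 0 < s) t 0 p_infty Ht0 I
          (fun s Hs _ => Hs)).
        apply filter_imp; intros s Hs; symmetry.
        now apply is_derive_unique, is_derive_Gamma_integrand.
      * apply (continuous_minus (V := R_NormedModule)
          (fun s => a * Gamma_integrand a s)).
        -- apply (continuous_scal_r (V := R_NormedModule) a).
           now apply Gamma_integrand_continuous.
        -- now apply Gamma_integrand_continuous.
  - apply Gamma_integrand_lim_0; lra.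
  - apply Gamma_integrand_lim_infty; lra. }
refine (is_RInt_gen_unique (V := R_CompleteNormedModule)
  (Gamma_integrand (a + 1)) (a * Gamma a) _).
replace (a * Gamma a) with (minus (scal a (Gamma a)) (0 - 0))
  by (unfold minus, plus, opp, scal; simpl; unfold mult; simpl; ring).
apply (is_RInt_gen_ext (V := R_NormedModule)
  (fun t => minus (scal a (Gamma_integrand a t))
    (Derive (Gamma_integrand (a + 1)) t))).
- apply (Filter_prod _ _ _ (fun x => 0 < x) (fun y => 0 < y)).
  + now exists (mkposreal 1 Rlt_0_1).
  + now exists 0.
  + intros x y Hx Hy t Ht; simpl in Ht; pose proof (Rmin_pos x y Hx Hy).
    rewrite (is_derive_unique _ _ _ (is_derive_Gamma_integrand a t ltac:(lra))).
    unfold minus, plus, opp, scal, Gamma_integrand; simpl; unfold mult; simpl; ring.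
- apply (is_RInt_gen_minus (V := R_NormedModule)); [|exact HD].
  now apply (is_RInt_gen_scal (V := R_NormedModule)).
Qed.

(** * Laguerre polynomials *)

Lemma kummer_polynomial_P_e (n : nat) (b : R) (s : nat -> R) :
  INR n + 2 < b -> kummer_rec b (INR n) s -> s 0%nat = 1 -> P_e (egf s n).
Proof.
intros Hb Hs Hs0; pose proof (pos_INR n).
assert (Hv := kummer_rec_vanish b n s ltac:(lra) Hs).
assert (Hd : forall z, Cdiff (egf s n) z (egf (shift s) n z)).
{ intros z; apply Cdiff_egf, Hv; lia. }
assert (Hd1 : forall z, Ccont (egf (shift s) n) z).
{ intros z; apply (Cdiff_Ccont _ _ (egf (shift (shift s)) n z)), Cdiff_egf.
  unfold shift; apply Hv; lia. }
assert (H0 : egf s n (RtoC 0) = RtoC 1) by now rewrite egf_at_0, Hs0.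
assert (Hnz : forall z, unit_disc z ->
  egf s n z <> RtoC 0 /\ Cmod (egf (shift s) n z) <= Cmod (egf s n z)).
{ intros z Hz; apply (kummer_logderiv_bound n n b); try assumption;
    [lia|lra|now left]. }
repeat split.
- intros z _; eexists; apply Cdiff_is_derive, Hd.
- exact H0.
- apply (subordinate_exp_of_logderiv _
    (fun z => egf (shift s) n z / egf s n z)%C H0);
    intros z Hz; destruct (Hnz z Hz) as [Hz0 Hle].
  + replace (egf (shift s) n z / egf s n z * egf s n z)%C
      with (egf (shift s) n z) by (field; exact Hz0).
    apply Hd.
  + apply Ccont_div; [apply Hd1| |exact Hz0].
    exact (Cdiff_Ccont _ _ _ (Hd z)).
  + apply Cmod_gt_0 in Hz0; rewrite Cmod_div by now apply Cmod_gt_0.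
    apply (Rmult_le_reg_r (Cmod (egf s n z))); [exact Hz0|].
    unfold Rdiv; rewrite Rmult_assoc, Rinv_l; lra.
Qed.

Lemma Pochhammer_0 (a : R) : 1 < a -> Pochhammer a 0 = 1.
Proof.
intros Ha; unfold Pochhammer; simpl; rewrite Rplus_0_r.
destruct (is_RInt_gen_Gamma a Ha); field; lra.
Qed.

Lemma Pochhammer_S (a : R) (k : nat) : 1 < a ->
  Pochhammer a (S k) = (a + INR k) * Pochhammer a k.
Proof.
intros Ha; unfold Pochhammer; rewrite S_INR, <- Rplus_assoc, Gamma_S.
- unfold Rdiv; ring.
- pose proof (pos_INR k); lra.
Qed.

Lemma Pochhammer_pos (a : R) (k : nat) : 1 < a -> 0 < Pochhammer a k.
Proof.
intros Ha; pose proof (pos_INR k).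
apply Rdiv_lt_0_compat; apply is_RInt_gen_Gamma; lra.
Qed.

(** The explicit cutoff is needed because [n - k] truncates to 0 in [nat]: beyond [n] the formula
    would give nonzero values and break the recurrence. *)
Definition laguerre_coef (n : nat) (a : R) (k : nat) : R :=
  if le_dec k n
  then (-1) ^ k * INR (fact n) / (Pochhammer a k * INR (fact (n - k)))
  else 0.

Lemma M_egf (n : nat) (alpha : R) :
  M n alpha = egf (laguerre_coef n (1 + alpha)) n.
Proof.
apply functional_extensionality; intros z; unfold M, egf.
apply sum_n_ext_loc; intros k Hk; unfold laguerre_coef.
now destruct (le_dec k n).
Qed.

(** Consecutive coefficients have ratio [-(n - k) / (a + k)], from one factor of the factorial and
    one of the Pochhammer symbol; at [k = n] both sides vanish. *)
Lemma kummer_rec_laguerre_coef (n : nat) (a : R) :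
  1 < a -> kummer_rec a (INR n) (laguerre_coef n a).
Proof.
intros Ha k; unfold laguerre_coef.
destruct (le_dec (S k) n) as [H1|H1]; destruct (le_dec k n) as [H2|H2];
  try lia.
- rewrite Pochhammer_S, <- minus_INR by assumption.
  replace (n - k)%nat with (S (n - S k)) by lia.
  rewrite fact_simpl, mult_INR; simpl pow.
  pose proof (Pochhammer_pos a k Ha); pose proof (pos_INR k).
  field; repeat split; try apply INR_fact_neq_0; try lra.
  apply not_0_INR; lia.
- replace k with n by lia; ring.
- ring.
Qed.

Theorem theorem1 (alpha : R) (n : nat)
  (Halpha : alpha > -1)
  (H : 1 / exp 1 * (Re (RtoC alpha - RtoC 1)%C - INR n) > 0) :
  P_e (M n alpha).
Proof.
(* Cancelling the positive factor [1 / e] leaves [alpha - 1 > n]. *)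
assert (Ha : INR n + 2 < 1 + alpha).
{ simpl in H; apply Rnot_le_lt; intros Hle; revert H; apply Rle_not_gt.
  assert (0 < 1 / exp 1) by (apply Rdiv_lt_0_compat; [lra|apply exp_pos]).
  nra. }
pose proof (pos_INR n); rewrite M_egf.
apply (kummer_polynomial_P_e n (1 + alpha) _ Ha).
- apply kummer_rec_laguerre_coef; lra.
- unfold laguerre_coef; destruct (le_dec 0 n) as [_|]; [|lia].
  rewrite Pochhammer_0, Nat.sub_0_r by lra; simpl.
  field; apply INR_fact_neq_0.
Qed.
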